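(* Let $\mathbb{F}_q$ be a finite field of characteristic different from $2$ and $3$, let $E: y^2=x^3+Ax+B$ with $A,B\in\mathbb{F}_q$ be an elliptic curve, and let $n$ be an odd prime. Let $T_n$ be the trace zero subgroup of $E(\mathbb{F}_{q^n})$ associated with the field extension $\mathbb{F}_{q^n}|\mathbb{F}_q$, and let $f_n$ be the $n$-th summation polynomial of $E$. Then $$\bigcup_{k=0}^{\lfloor n/2\rfloor-1}\bigl(E[n-2k](\mathbb{F}_q)+(E[2]\cap T_n)\bigr)\ \subseteq\ \{(X,Y)\in E(\mathbb{F}_{q^n}) \mid f_n(X,X^q,\ldots,X^{q^{n-1}})=0\}\cup\{\mathcal{O}\},$$ where for subgroups $G,H$ of $E(\overline{\mathbb{F}}_q)$ we write $G+H=\{Q+R\mid Q\in G,\ R\in H\}$.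
   Context: $\mathcal{O}$ denotes the point at infinity, the neutral element of $E$. For an integer $m$, $E[m]$ is the group of $m$-torsion points of $E$ over the algebraic closure $\overline{\mathbb{F}}_q$, and $E[m](\mathbb{F}_q)$ is its subgroup of $\mathbb{F}_q$-rational points. The Frobenius endomorphism is $\varphi:E\to E$, $(X,Y)\mapsto(X^q,Y^q)$, $\mathcal{O}\mapsto\mathcal{O}$. The trace map is $\mathrm{Tr}:E(\mathbb{F}_{q^n})\to E(\mathbb{F}_q)$, $P\mapsto P+\varphi(P)+\cdots+\varphi^{n-1}(P)$, and the trace zero subgroup is $T_n=\ker(\mathrm{Tr})\subseteq E(\mathbb{F}_{q^n})$. Semaev's summation polynomials $f_m\in\mathbb{F}_q[z_1,\ldots,z_m]$, $m\ge 3$, of $E$ are defined recursively by $$f_3(z_1,z_2,z_3)=(z_1-z_2)^2z_3^2-2\bigl((z_1+z_2)(z_1z_2+A)+2B\bigr)z_3+(z_1z_2-A)^2-4B(z_1+z_2),$$ $$f_m(z_1,\ldots,z_m)=\mathrm{Res}_z\bigl(f_{m-k}(z_1,\ldots,z_{m-k-1},z),\,f_{k+2}(z_{m-k},\ldots,z_m,z)\bigr)$$ for $m\ge4$ and $m-3\ge k\ge1$. A known theorem of Semaev, which may be used: for $m\geq 3$ and $Z_1,\ldots,Z_m\in\overline{\mathbb{F}}_q$, one has $f_m(Z_1,\ldots,Z_m)=0$ if and only if there exist $Y_1,\ldots,Y_m\in\overline{\mathbb{F}}_q$ such that the points $(Z_i,Y_i)$ lie on $E$ and $(Z_1,Y_1)+\cdots+(Z_m,Y_m)=\mathcal{O}$.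 Moreover $f_m$ is symmetric. *)

(* Defs.v *)
From HB Require Import structures.
From mathcomp Require Import all_boot all_order all_algebra.
From mathcomp Require Import classical_sets.
From mathcomp Require Import mpoly.

Set Implicit Arguments.
Unset Strict Implicit.
Unset Printing Implicit Defensive.

Import GRing.Theory.

Local Open Scope ring_scope.
Local Open Scope classical_set_scope.

(** * The group law on a short Weierstrass curve *)

Variant point (L : Type) := Inf | Aff of L & L.

Arguments Inf {L}.

(* [E(L)] for the curve y^2 = x^3 + A x + B. *)
Definition curve (L : fieldType) (A B : L) : set (point L) :=
  [set P | if P is Aff x y then y ^+ 2 = x ^+ 3 + A * x + B else True].

(* Chord-and-tangent addition.  It is total on [point L] but meaningful only on
   points of [curve A B]: there, two points with the same abscissa have equal or
   opposite ordinates, so the tangent case is reached only for P = Q with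
   y <> 0. *)
Definition padd (L : fieldType) (A : L) (P Q : point L) : point L :=
  match P, Q with
  | Inf, _ => Q
  | _, Inf => P
  | Aff x1 y1, Aff x2 y2 =>
      if (x1 == x2) && (y1 == - y2) then Inf else
      let s := if x1 == x2 then (3%:R * x1 ^+ 2 + A) / (2%:R * y1)
               else (y2 - y1) / (x2 - x1) in
      let x3 := s ^+ 2 - x1 - x2 in
      Aff x3 (s * (x1 - x3) - y1)
  end.

Definition pmul (L : fieldType) (A : L) (m : nat) (P : point L) : point L :=
  iter m (padd A P) Inf.

(* G + H *)
Definition set_padd (L : fieldType) (A : L) (G H : set (point L)) :=
  [set padd A Q R | Q in G & R in H].

(* E[m] (all m-torsion, provided that L is algebraically closed) *)
Definition torsion (L : fieldType) (A B : L) (m : nat) : set (point L) :=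
  [set P | curve A B P /\ pmul A m P = Inf].

(* E(k), inside E(L), for a subfield h : k -> L *)
Definition rational (k L : fieldType) (h : k -> L) (A B : L) :
    set (point L) :=
  [set P | curve A B P /\
           if P is Aff x y then range h x /\ range h y else True].

(** * Frobenius, trace, trace zero subgroup *)

Definition frob (L : fieldType) (q : nat) (P : point L) : point L :=
  if P is Aff x y then Aff (x ^+ q) (y ^+ q) else Inf.

Definition trace (L : fieldType) (A : L) (q n : nat) (P : point L) : point L :=
  \big[padd A/Inf]_(i < n) iter i (frob q) P.

(* h : K -> L is the inclusion of the extension of degree n of F_q. *)
Definition trace_zero (K L : fieldType) (h : K -> L) (A B : L) (q n : nat) :
    set (point L) :=
  [set P | rational h A B P /\ trace A q n P = Inf].

(** * Summation polynomials *)

Definition semaev3 (R : comNzRingType) (A B z1 z2 z3 : R) : R :=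
  (z1 - z2) ^+ 2 * z3 ^+ 2
  - 2%:R * ((z1 + z2) * (z1 * z2 + A) + 2%:R * B) * z3
  + ((z1 * z2 - A) ^+ 2 - 4%:R * B * (z1 + z2)).

(* f(z_(s 0), ..., z_(s (a-1)), z), as a polynomial in z with coefficients in
   R[z_0, ..., z_(m-1)]; the last variable of f becomes z. *)
Definition mpoly_last (R : comNzRingType) (a m : nat) (s : 'I_a -> 'I_m)
    (f : {mpoly R[a.+1]}) : {poly {mpoly R[m]}} :=
  mmap (polyC \o @mpolyC m R)
    (fun i : 'I_a.+1 => if unlift ord_max i is Some k then ('X_(s k))%:P
                        else 'X)
    f.

(* [summation_poly A B f], for f in m variables: f is obtained by the recursion
   defining the m-th summation polynomial, with an arbitrary choice of k at each
   step.  For f_m = Res_z(f_(m-k), f_(k+2)) with 1 <= k <= m - 3, put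
   a = m - k - 1 and b = k + 1, so that m = a + b: the first factor involves
   z_1, ..., z_a and the second one the remaining b variables.  The bounds on k
   say that both factors have at least 3 variables, which holds because no
   constructor produces fewer. *)
Inductive summation_poly (F : fieldType) (A B : F) :
    forall m, {mpoly F[m]} -> Prop :=
| Summation3 :
    summation_poly A B
      (semaev3 A%:MP_[3] B%:MP_[3]
         'X_(inord 0) 'X_(inord 1) 'X_(inord 2))
| SummationRes a b (f : {mpoly F[a.+1]}) (g : {mpoly F[b.+1]}) :
    summation_poly A B f -> summation_poly A B g ->
    summation_poly A B
      (resultant (mpoly_last (@lshift a b) f) (mpoly_last (@rshift a b) g)).

Lemma summation_poly_ex (F : fieldType) (A B : F) m :
  (2 < m)%N -> exists f : {mpoly F[m]}, summation_poly A B f.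
Proof.
case: m => [|[|[|m]]] // _; elim: m => [|m [f Hf]].
  by eexists; apply: Summation3.
by rewrite -[m.+4]addn2; eexists; exact: SummationRes Hf (Summation3 A B).
Qed.

(* Main.v *)
(* The Frobenius fixes Q and permutes the conjugates of R, so the i-th conjugate
   of P = Q + R is Q + R_i with R_i a 2-torsion point.  Adding n - k of these
   conjugates and subtracting the other k gives (n - 2k)Q plus the sum of the R_i,
   which is the trace of R; both vanish.  A change of sign does not affect the
   abscissa, so f_n vanishes at the conjugates of X by the easy half of Semaev's
   theorem: if points add up to O, then f_m vanishes at their abscissae.

   In Semaev's theorem, the sum S of the points of one block gives a common root
   x(S) of the two factors of a resultant, but S may be O.  This is dealt with by
   homogenizing in every variable, O having abscissa (1 : 0).  The resultant is the
   Sylvester determinant of these forms only if their leading coefficients do not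
   vanish identically; this is checked at the point where all variables but one
   are at infinity, where f_m becomes a constant times a power of the remaining
   denominator.

   Associativity of the group law becomes easy in terms of slopes: if l and m are
   the slopes of PQ and QR, then the slopes of (P + Q)R and P(Q + R) are - l + w
   and - m + w with w = (x(P) - x(R)) / (l - m). *)

From HB Require Import structures.
Require Import Defs.
From mathcomp Require Import all_boot all_order all_algebra.
From mathcomp Require Import all_fingroup all_solvable all_field.
From mathcomp Require Import classical_sets.
From mathcomp Require Import mpoly ssrcomplements.
From mathcomp Require Import ring zify.

Set Implicit Arguments.
Unset Strict Implicit.
Unset Printing Implicit Defensive.

(* [classical_sets] has another [point]. *)
Import Defs.
Import GRing.Theory.
Local Open Scope ring_scope.

(** * The group law *)

Section GroupLaw.
Variables (L : fieldType) (a b : L).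
Hypothesis two_neq0 : 2%:R != 0 :> L.
Hypothesis disc_neq0 : 4%:R * a ^+ 3 + 27%:R * b ^+ 2 != 0.

Definition popp (P : point L) : point L :=
  if P is Aff x y then Aff x (- y) else Inf.

(* Chords and tangents at once: the second equation determines [l] when
   (x1, y1) = (x2, y2), and for x1 <> x2 it follows from the first one. *)
Definition slope (x1 y1 x2 y2 l : L) : Prop :=
  y2 - y1 = l * (x2 - x1) /\ l * (y1 + y2) = x1 ^+ 2 + x1 * x2 + x2 ^+ 2 + a.

Definition third (x1 y1 x2 l : L) : point L :=
  let x3 := l ^+ 2 - x1 - x2 in Aff x3 (l * (x1 - x3) - y1).

(** The difference of two slopes annihilates both [x2 - x1] and [y1 + y2], so it can be nonzero only
    for opposite points. *)
Lemma slope_uniq x1 y1 x2 y2 l l' :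
  ~~ ((x1 == x2) && (y1 == - y2)) ->
  slope x1 y1 x2 y2 l -> slope x1 y1 x2 y2 l' -> l = l'.
Proof.
move=> nopp [E1 E2] [E1' E2']; apply/eqP; rewrite -subr_eq0; apply/negPn/negP => ll'.
have /eqP : (l - l') * (x2 - x1) = 0 by rewrite mulrBl -E1 -E1' subrr.
rewrite mulf_eq0 (negPf ll') subr_eq0 => /eqP Ex.
have /eqP : (l - l') * (y1 + y2) = 0 by rewrite mulrBl E2 E2' subrr.
rewrite mulf_eq0 (negPf ll') addr_eq0 => /eqP Ey.
by move: nopp; rewrite Ex Ey !eqxx.
Qed.

Lemma padd_slope_ex x1 y1 x2 y2 :
  curve a b (Aff x1 y1) -> curve a b (Aff x2 y2) ->
  ~~ ((x1 == x2) && (y1 == - y2)) ->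
  exists2 l, slope x1 y1 x2 y2 l &
    padd a (Aff x1 y1) (Aff x2 y2) = third x1 y1 x2 l.
Proof.
rewrite /curve /= => C1 C2 nopp; rewrite /padd (negPf nopp) /=.
(* The difference of the two curve equations, factored. For distinct abscissae it yields the second
   slope equation, for equal ones it forces [y2 = y1]. *)
have sqB : (y2 - y1) * (y1 + y2) = (x2 - x1) * (x1 ^+ 2 + x1 * x2 + x2 ^+ 2 + a).
  have -> : (y2 - y1) * (y1 + y2) = y2 ^+ 2 - y1 ^+ 2 by ring.
  by rewrite C1 C2; ring.
case: (eqVneq x1 x2) nopp sqB => [<-|nex] /= nopp sqB; last first.
  have d : x2 - x1 != 0 by rewrite subr_eq0 eq_sym.
  exists ((y2 - y1) / (x2 - x1)) => //; split; first by rewrite divfK.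
  by apply: (mulfI d); rewrite -sqB; field.
have Ey : y2 = y1.
  move/eqP: sqB; rewrite subrr mul0r mulf_eq0 subr_eq0 => /orP[/eqP //|].
  by rewrite addr_eq0 (negPf nopp).
have y0 : y1 != 0.
  by apply: contraNneq nopp => y10; rewrite Ey y10 oppr0.
exists ((3%:R * x1 ^+ 2 + a) / (2%:R * y1)) => //; split; rewrite Ey.
  by rewrite !subrr mulr0.
by field; rewrite y0.
Qed.

Lemma padd_slope x1 y1 x2 y2 l :
  curve a b (Aff x1 y1) -> curve a b (Aff x2 y2) ->
  ~~ ((x1 == x2) && (y1 == - y2)) -> slope x1 y1 x2 y2 l ->
  padd a (Aff x1 y1) (Aff x2 y2) = third x1 y1 x2 l.
Proof.
move=> C1 C2 nopp sl; have [l' sl' ->] := padd_slope_ex C1 C2 nopp.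
by rewrite (slope_uniq nopp sl sl').
Qed.

Lemma padd_opp x y : padd a (Aff x y) (Aff x (- y)) = Inf.
Proof. by rewrite /padd opprK !eqxx. Qed.

Lemma curve_popp P : curve a b P -> curve a b (popp P).
Proof. by case: P => //= x y; rewrite /curve /= sqrrN. Qed.

Lemma poppK : involutive popp.
Proof. by case=> //= x y; rewrite opprK. Qed.

(* With [x1], [y1], [x2] and [l] as free coordinates, all identities on the curve
   become polynomial. *)
Lemma slopeE x1 y1 x2 y2 l :
  curve a b (Aff x1 y1) -> slope x1 y1 x2 y2 l ->
  [/\ y2 = y1 + l * (x2 - x1),
      a = l * (2%:R * y1 + l * (x2 - x1)) - (x1 ^+ 2 + x1 * x2 + x2 ^+ 2) &
      b = y1 ^+ 2 - x1 ^+ 3 - a * x1].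
Proof.
rewrite /curve /= => C1 [E1 E2].
have Ey : y2 = y1 + l * (x2 - x1) by rewrite -E1; ring.
split=> //; last by rewrite C1; ring.
have -> : 2%:R * y1 + l * (x2 - x1) = y1 + y2 by rewrite Ey; ring.
by rewrite E2; ring.
Qed.

Lemma curve_third x1 y1 x2 y2 l :
  curve a b (Aff x1 y1) -> slope x1 y1 x2 y2 l ->
  curve a b (third x1 y1 x2 l).
Proof.
move=> C1 sl; have [_ Ea Eb] := slopeE C1 sl.
by rewrite /curve /= Eb Ea; ring.
Qed.

Lemma curve_padd P Q : curve a b P -> curve a b Q -> curve a b (padd a P Q).
Proof.
case: P => [//|x1 y1]; case: Q => [//|x2 y2] C1 C2.
have [opp|nopp] := boolP ((x1 == x2) && (y1 == - y2)).
  by rewrite /padd opp.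
have [l sl ->] := padd_slope_ex C1 C2 nopp; exact: curve_third sl.
Qed.

Lemma paddC P Q : curve a b P -> curve a b Q -> padd a P Q = padd a Q P.
Proof.
case: P => [|x1 y1]; case: Q => [|x2 y2] // C1 C2.
have [/andP[/eqP -> /eqP ->]|nopp] := boolP ((x1 == x2) && (y1 == - y2)).
  by rewrite padd_opp /padd !eqxx.
have nopp' : ~~ ((x2 == x1) && (y2 == - y1)).
  by rewrite eq_sym (eq_sym y2) eqr_oppLR.
have [l sl ->] := padd_slope_ex C1 C2 nopp.
have [Ey _ _] := slopeE C1 sl.
case: sl => E1 E2; rewrite (@padd_slope _ _ _ _ l) //; last first.
  by split; [rewrite -opprB E1; ring|rewrite addrC E2; ring].
by rewrite /third Ey; congr Aff; ring.
Qed.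

Lemma padd_popp P Q : curve a b P -> curve a b Q ->
  padd a (popp P) (popp Q) = popp (padd a P Q).
Proof.
case: P => [|x1 y1]; case: Q => [|x2 y2] // C1 C2.
have [opp|nopp] := boolP ((x1 == x2) && (y1 == - y2)).
  by rewrite /padd /= eqr_opp opp.
have [l [E1 E2] ->] := padd_slope_ex C1 C2 nopp.
rewrite {1 2}/popp (@padd_slope _ _ _ _ (- l)) /third.
- by rewrite sqrrN; congr Aff; ring.
- exact: (curve_popp (P := Aff x1 y1)).
- exact: (curve_popp (P := Aff x2 y2)).
- by rewrite eqr_opp.
- by split; [rewrite mulNr -E1; ring|rewrite -E2; ring].
Qed.

(** Such a point is singular: [a = - 3 x^2] and [b = 2 x^3], which kills the discriminant. *)
Lemma singular_disc x y : curve a b (Aff x y) -> y = 0 ->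
  3%:R * x ^+ 2 + a = 0 -> 4%:R * a ^+ 3 + 27%:R * b ^+ 2 = 0.
Proof.
rewrite /curve /= => C Ey Ex.
have Ea : a = - (3%:R * x ^+ 2) by apply/eqP; rewrite -addr_eq0 addrC Ex.
have Eb : b = y ^+ 2 - x ^+ 3 - a * x by rewrite C; ring.
by rewrite Eb Ey Ea; ring.
Qed.

Lemma padd_poppK P Q : curve a b P -> curve a b Q ->
  padd a (popp P) (padd a P Q) = Q.
Proof.
case: P => [//|x1 y1]; case: Q => [|x2 y2] C1 C2.
  by rewrite paddC ?padd_opp //; exact: (curve_popp (P := Aff _ _)).
have CN := curve_popp C1.
have [/andP[/eqP Ex /eqP Ey]|nopp] := boolP ((x1 == x2) && (y1 == - y2)).
  by rewrite Ex Ey /padd /= ?eqxx ?opprK /= ?eqxx.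
have [l sl ->] := padd_slope_ex C1 C2 nopp.
have CT := curve_third C1 sl.
have [Ey Ea Eb] := slopeE C1 sl.
(* P, Q and - (P + Q) lie on a line of slope [l]; its reflection passes through - P and P + Q with
   slope [- l] and meets the curve again in - Q. *)
have slN : slope x1 (- y1) (l ^+ 2 - x1 - x2)
             (l * (x1 - (l ^+ 2 - x1 - x2)) - y1) (- l).
  by split; [ring|rewrite Ea; ring].
have [/andP[/eqP Ex /eqP Eyy]|nopp'] := boolP
  ((x1 == l ^+ 2 - x1 - x2) && (- y1 == - (l * (x1 - (l ^+ 2 - x1 - x2)) - y1))).
  (* Here P + Q = P. This forces [y1 = 0], and the second slope equation then makes P a singular
     point. *)
  exfalso; move: Eyy; rewrite -Ex subrr mulr0 sub0r opprK => Eyy.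
  have y0 : y1 = 0.
    apply/eqP; have /eqP : 2%:R * y1 = 0 by rewrite mulr_natl mulr2n -{1}Eyy addNr.
    by rewrite mulf_eq0 (negPf two_neq0).
  case/eqP: disc_neq0; apply: (singular_disc C1 y0).
  case: slN => _; rewrite -Ex y0 subrr mulr0 !(oppr0, addr0) mulr0 => ->.
  ring.
rewrite {1}/third {1}/popp (padd_slope _ _ nopp' slN) //.
by rewrite /third Ey; congr Aff; ring.
Qed.

Lemma padd_popp_r P : curve a b P -> padd a P (popp P) = Inf.
Proof. by case: P => // x y _; exact: padd_opp. Qed.

Lemma eq_popp x1 y1 x2 y2 :
  (x1 == x2) && (y1 == - y2) -> Aff x1 y1 = popp (Aff x2 y2).
Proof. by case/andP=> /eqP -> /eqP ->. Qed.

(** Each slope gives an expression for [a]. Equating them leaves a linear equation for [y1] with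
    coefficient [2 (l - m)], so that [x2], [x3], [l], [m], [w] become free coordinates. *)
Lemma slopes_y x1 y1 x2 y2 x3 y3 l m w :
  curve a b (Aff x1 y1) -> curve a b (Aff x2 y2) ->
  slope x1 y1 x2 y2 l -> slope x2 y2 x3 y3 m -> l != m -> x1 = x3 + w * (l - m) ->
  y1 = (w * (x1 + x2 + x3 - m ^+ 2) + (l - m) * (x1 - x2)) / 2%:R.
Proof.
move=> C1 C2 sl sm lm Ew.
have d : l - m != 0 by rewrite subr_eq0.
have [Ey2 Ea _] := slopeE C1 sl; have [_ Ea' _] := slopeE C2 sm.
apply: (mulIf two_neq0); rewrite divfK //; apply: (mulIf d).
apply/eqP; rewrite -subr_eq0; apply/eqP.
move/eqP: Ea'; rewrite {1}Ea Ey2 -subr_eq0 => /eqP <-.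
rewrite Ew; ring.
Qed.

Lemma slope_double x1 y1 x2 y2 x3 y3 l m w :
  curve a b (Aff x1 y1) -> curve a b (Aff x2 y2) ->
  slope x1 y1 x2 y2 l -> slope x2 y2 x3 y3 m -> l != m -> x1 = x3 + w * (l - m) ->
  let xs := l ^+ 2 - x1 - x2 in
  slope xs (l * (x1 - xs) - y1) x3 y3 (- l + w).
Proof.
move=> C1 C2 sl sm lm Ew xs.
have Ey := slopes_y C1 C2 sl sm lm Ew.
have [Ey2 Ea _] := slopeE C1 sl; have [Ey3 _ _] := slopeE C2 sm.
by split; rewrite /xs ?Ea Ey3 Ey2 Ey Ew; field.
Qed.

Lemma slopeC x1 y1 x2 y2 l : slope x1 y1 x2 y2 l -> slope x2 y2 x1 y1 l.
Proof.
by case=> E1 E2; split; [rewrite -opprB E1; ring|rewrite addrC E2; ring].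
Qed.

Lemma paddA P Q R : curve a b P -> curve a b Q -> curve a b R ->
  padd a P (padd a Q R) = padd a (padd a P Q) R.
Proof.
move=> CP CQ CR.
have padd_oppK U V : curve a b U -> curve a b V -> padd a U (padd a (popp U) V) = V.
  by move=> CU CV; rewrite -{1}(poppK U) padd_poppK //; exact: curve_popp.
case: P CP => [//|x1 y1] CP; case: Q CQ => [//|x2 y2] CQ.
case: R CR => [|x3 y3] CR.
  by rewrite (paddC (curve_padd CP CQ) CR) (paddC CQ CR).
have [/eq_popp EP|noppPQ] := boolP ((x1 == x2) && (y1 == - y2)).
  have -> : padd a (Aff x1 y1) (Aff x2 y2) = Inf.
    by rewrite EP paddC ?padd_popp_r //; exact: curve_popp.
  by rewrite EP padd_poppK.
have [/eq_popp EQ|noppQR] := boolP ((x2 == x3) && (y2 == - y3)).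
  have -> : padd a (Aff x2 y2) (Aff x3 y3) = Inf.
    by rewrite EQ paddC ?padd_popp_r //; exact: curve_popp.
  rewrite [in RHS]paddC //; last by apply: curve_padd.
  by rewrite EQ [in RHS](paddC CP) ?padd_oppK //; exact: curve_popp.
have [l sl EPQ] := padd_slope_ex CP CQ noppPQ.
have [m sm EQR] := padd_slope_ex CQ CR noppQR.
have CPQ := curve_padd CP CQ; have CQR := curve_padd CQ CR.
pose xs := l ^+ 2 - x1 - x2; pose xt := m ^+ 2 - x2 - x3.
pose ys := l * (x1 - xs) - y1; pose yt := m * (x2 - xt) - y2.
have [opp|nopp1] := boolP ((xs == x3) && (ys == - y3)).
  have ER : Aff x3 y3 = popp (padd a (Aff x1 y1) (Aff x2 y2)).
    by rewrite EPQ -[third _ _ _ _]/(Aff xs ys) (eq_popp opp) poppK.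
  rewrite ER padd_popp_r // -padd_popp // [X in padd a (Aff x2 y2) X]paddC;
    try exact: curve_popp.
  by rewrite padd_oppK ?padd_popp_r //; exact: curve_popp.
have [opp|nopp2] := boolP ((x1 == xt) && (y1 == - yt)).
  have EP : Aff x1 y1 = popp (padd a (Aff x2 y2) (Aff x3 y3)).
    by rewrite EQR -[third _ _ _ _]/(Aff xt yt) -(eq_popp opp).
  have -> : padd a (Aff x1 y1) (padd a (Aff x2 y2) (Aff x3 y3)) = Inf.
    by rewrite EP paddC ?padd_popp_r //; exact: curve_popp.
  rewrite EP -padd_popp // (paddC _ CQ);
    try by [exact: curve_popp|apply: curve_padd; exact: curve_popp].
  by rewrite padd_oppK // 1?paddC ?padd_popp_r //; exact: curve_popp.
(* Both lines pass through Q, so equal slopes make them the same line. Apart from Q it meets the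
   curve in P and - (P + Q), so R is one of these; the second has been excluded, and for R = P
   commutativity suffices. *)
have [Elm|lm] := eqVneq l m.
  have [Ey2 Ea _] := slopeE CP sl; have [Ey3 Ea' _] := slopeE CQ sm.
  have /eqP : (x1 - x3) * (xs - x3) = 0.
    move: Ea'; rewrite {1}Ea Ey2 -Elm => /eqP; rewrite -subr_eq0 => /eqP E.
    by rewrite -[RHS]E /xs; ring.
  rewrite mulf_eq0 !subr_eq0 => /orP[/eqP E13|/eqP Es3].
    have -> : Aff x3 y3 = Aff x1 y1.
      by rewrite -E13 Ey3 -Elm Ey2 -E13; congr Aff; ring.
    by rewrite (paddC CPQ CP) (paddC CQ CP).
  case/negP: nopp1; rewrite Es3 eqxx /=; apply/eqP.
  by rewrite /ys Es3 Ey3 Ey2 -Elm; ring.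
have d : l - m != 0 by rewrite subr_eq0.
pose w := (x1 - x3) / (l - m).
have Ew : x1 = x3 + w * (l - m) by rewrite divfK // addrC subrK.
have sl1 := slope_double CP CQ sl sm lm Ew.
have [Ey2 Ea _] := slopeE CP sl; have [Ey3 Ea' _] := slopeE CQ sm.
(* Reversing the triple to R, Q, P exchanges [l] and [m] and preserves [w]. *)
have sl2 : slope x1 y1 xt yt (- m + w).
  have := slope_double CR CQ (slopeC sm) (slopeC sl) _ _ (w := w).
  rewrite eq_sym => /(_ lm) /=.
  have -> : m ^+ 2 - x3 - x2 = xt by rewrite /xt; ring.
  have -> : m * (x3 - xt) - y3 = yt by rewrite /yt Ey3; ring.
  by move=> H; apply/slopeC/H; rewrite Ew; ring.
rewrite EPQ EQR in CPQ CQR *.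
rewrite (padd_slope CP CQR nopp2 sl2) (padd_slope CPQ CR nopp1 sl1).
have Ey := slopes_y CP CQ sl sm lm Ew.
rewrite /third; clearbody w; congr Aff.
  by rewrite /xt /xs Ew; ring.
by rewrite /xt Ey /xs Ew; field.
Qed.
End GroupLaw.

(** * Base change of points along field morphisms *)

Definition point_map (k L : Type) (h : k -> L) (P : point k) : point L :=
  if P is Aff x y then Aff (h x) (h y) else Inf.

Lemma padd_map (k L : fieldType) (h : {rmorphism k -> L}) (a : k) P Q :
  padd (h a) (point_map h P) (point_map h Q) = point_map h (padd a P Q).
Proof.
case: P Q => [|x1 y1] [|x2 y2] //=.
rewrite -rmorphN !(inj_eq (fmorph_inj h)); case: ifP => //= _.
by case: eqP => _; rewrite !(rmorph_nat, rmorphXn, fmorphV, rmorphM, rmorphB, rmorphD).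
Qed.

Lemma curve_map (k L : fieldType) (h : {rmorphism k -> L}) (a b : k) P :
  curve (h a) (h b) (point_map h P) <-> curve a b P.
Proof.
case: P => // x y; rewrite /curve /= -!rmorphXn -rmorphM -!rmorphD.
by split=> [/fmorph_inj|->].
Qed.

(** * The curve as an abelian group *)

Definition point_code (L : Type) (P : point L) : option (L * L) :=
  if P is Aff x y then Some (x, y) else None.

Definition point_decode (L : Type) (c : option (L * L)) : point L :=
  if c is Some (x, y) then Aff x y else Inf.

Lemma point_codeK (L : Type) : cancel (@point_code L) (@point_decode L).
Proof. by case. Qed.

HB.instance Definition _ (L : choiceType) :=
  Choice.copy (point L) (can_type (@point_codeK L)).

(** Membership is made boolean so that points of the subtype are equal as soon as their underlying
    points are. *)
Definition oncurve (L : fieldType) (a b : L) (P : point L) : bool :=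
  if P is Aff x y then y ^+ 2 == x ^+ 3 + a * x + b else true.

Lemma oncurveP (L : fieldType) (a b : L) (P : point L) :
  reflect (curve a b P) (oncurve a b P).
Proof. by case: P => [|x y]; [apply: ReflectT | apply: eqP]. Qed.

(** Both hypotheses are parameters of the type because the group structure attached to it is built
    from them. *)
Definition curve_pt (L : fieldType) (a b : L)
  of 2%:R != 0 :> L & 4%:R * a ^+ 3 + 27%:R * b ^+ 2 != 0 :=
  {P : point L | oncurve a b P}.

Section CurveGroup.
Variables (L : fieldType) (a b : L).
Hypothesis two_neq0 : 2%:R != 0 :> L.
Hypothesis disc_neq0 : 4%:R * a ^+ 3 + 27%:R * b ^+ 2 != 0.

Local Notation E := (curve_pt two_neq0 disc_neq0).

HB.instance Definition _ := Choice.on E.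

Definition ecval (P : E) : point L := sval P.

Lemma ecvalP (P : E) : curve a b (ecval P).
Proof. by apply/oncurveP; case: P. Qed.

Lemma ecval_inj : injective ecval.
Proof. exact: val_inj. Qed.

Definition ec (P : point L) (CP : curve a b P) : E :=
  exist _ P (introT (oncurveP a b P) CP).

Definition ec_add (P Q : E) : E := ec (curve_padd two_neq0 (ecvalP P) (ecvalP Q)).
Definition ec_opp (P : E) : E := ec (curve_popp (ecvalP P)).
Definition ec_zero : E := ec (P := Inf) I.

Lemma ec_addA : associative ec_add.
Proof.
by move=> P Q R; apply: ecval_inj; apply: (@paddA _ a b) => //; exact: ecvalP.
Qed.

Lemma ec_addC : commutative ec_add.
Proof.
by move=> P Q; apply: ecval_inj; apply: (@paddC _ a b) => //; exact: ecvalP.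
Qed.

Lemma ec_add0 : left_id ec_zero ec_add.
Proof. by move=> P; apply: ecval_inj. Qed.

Lemma ec_addN : left_inverse ec_zero ec_opp ec_add.
Proof.
move=> P; rewrite ec_addC; apply: ecval_inj; exact: padd_popp_r (ecvalP P).
Qed.

HB.instance Definition _ :=
  GRing.isZmodule.Build E ec_addA ec_addC ec_add0 ec_addN.

Lemma ecvalD P Q : ecval (P + Q) = padd a (ecval P) (ecval Q).
Proof. by []. Qed.

Lemma ecvalN P : ecval (- P) = popp (ecval P).
Proof. by []. Qed.

Lemma ecval0 : ecval 0 = Inf.
Proof. by []. Qed.

Lemma ecvalMn P m : ecval (P *+ m) = pmul a m (ecval P).
Proof. by elim: m => // m IHm; rewrite mulrS ecvalD IHm. Qed.

Lemma ecval_sum n (P : 'I_n -> E) :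
  ecval (\sum_i P i) = \big[padd a/Inf]_i ecval (P i).
Proof. exact: (big_morph ecval ecvalD ecval0). Qed.
End CurveGroup.

(** * Homogenized evaluation and resultants *)

Section DegreeBound.
Variables (n : nat) (R : comNzRingType).
Implicit Types (e : 'I_n -> nat) (f g : {mpoly R[n]}).

Definition mdeg_le e f := forall m, m \in msupp f -> forall i, (m i <= e i)%N.

Lemma mdeg_leD e f g : mdeg_le e f -> mdeg_le e g -> mdeg_le e (f + g).
Proof.
by move=> Hf Hg m /msuppD_le; rewrite mem_cat => /orP[/Hf|/Hg].
Qed.

Lemma mdeg_le0 e : mdeg_le e 0.
Proof. by move=> m; rewrite msupp0. Qed.

Lemma mdeg_leN e f : mdeg_le e f -> mdeg_le e (- f).
Proof. by move=> Hf m; rewrite (perm_mem (msuppN f)) => /Hf. Qed.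

Lemma mdeg_le_sum (I : eqType) (r : seq I) (P : pred I) e (F : I -> {mpoly R[n]}) :
  (forall k, k \in r -> P k -> mdeg_le e (F k)) ->
  mdeg_le e (\sum_(k <- r | P k) F k).
Proof.
move=> HF; rewrite big_seq_cond; elim/big_rec: _ => [|k f /andP[rk Pk] Hf].
  exact: mdeg_le0.
by apply: mdeg_leD => //; exact: HF.
Qed.

Lemma mdeg_leZX e c (m : 'X_{1..n}) : (forall i, (m i <= e i)%N) -> mdeg_le e (c *: 'X_[m]).
Proof. by move=> Hm m' /msuppZ_le; rewrite msuppX inE => /eqP ->. Qed.

Lemma mdeg_leM e1 e2 f g : mdeg_le e1 f -> mdeg_le e2 g ->
  mdeg_le (fun i => e1 i + e2 i)%N (f * g).
Proof.
move=> Hf Hg m /msuppM_le /allpairsP[[m1 m2] /= [/Hf H1 /Hg H2 ->]] i.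
by rewrite mnmDE leq_add.
Qed.

Lemma mdeg_le1 e : mdeg_le e 1.
Proof. by move=> m; rewrite msupp1 inE => /eqP -> i; rewrite mnm0E. Qed.

Lemma mdeg_le_prod (I : Type) (r : seq I) (e : I -> 'I_n -> nat)
    (F : I -> {mpoly R[n]}) :
  (forall k, mdeg_le (e k) (F k)) ->
  mdeg_le (fun i => \sum_(k <- r) e k i)%N (\prod_(k <- r) F k).
Proof.
move=> HF; elim: r => [|k r IHr].
  by rewrite big_nil => m Hm i; rewrite big_nil; exact: (@mdeg_le1 (fun=> 0%N)).
rewrite big_cons => m Hm i; rewrite big_cons.
exact: (mdeg_leM (HF k) IHr).
Qed.

(** Bounds are attached to rows: each term of the Leibniz expansion takes exactly one entry from
    every row. *)
Lemma mdeg_le_det N (e : 'I_N -> 'I_n -> nat) (M : 'M[{mpoly R[n]}]_N) :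
  (forall k j, mdeg_le (e k) (M k j)) ->
  mdeg_le (fun i => \sum_k e k i)%N (\det M).
Proof.
move=> HM; apply: mdeg_le_sum => s _ _; rewrite mulr_sign.
have H := @mdeg_le_prod _ (index_enum 'I_N) e (fun k => M k (s k)) (fun k => HM k _).
by case: (s : bool) => //; exact: mdeg_leN.
Qed.
End DegreeBound.

(* Value at [v] of the multihomogenization of [f], where [e i] is the degree in
   the i-th pair of variables; meaningful if [mdeg_le e f]. *)
Section HomogeneousValue.
Variables (n : nat) (R S : comNzRingType) (h : {rmorphism R -> S}).
Implicit Types (e : 'I_n -> nat) (v : 'I_n -> S * S) (f g : {mpoly R[n]}).

Definition mnm_hval e v (m : 'X_{1..n}) : S :=
  \prod_i ((v i).1 ^+ m i * (v i).2 ^+ (e i - m i)).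

Definition hval e v f : S := \sum_(m <- msupp f) h f@_m * mnm_hval e v m.

(** Summing over an index set common to several polynomials, instead of the support of each, is what
    gives additivity. *)
Lemma hvalE e v f k : (msize f <= k)%N ->
  hval e v f = \sum_(m : 'X_{1..n < k}) h f@_m * mnm_hval e v m.
Proof.
move=> le_fk; rewrite /hval (big_mksub 'X_{1..n < k}) ?msupp_uniq //=; first last.
  by move=> x /msize_mdeg_lt /leq_trans; apply.
by rewrite big_rmcond //= => j /memN_msupp_eq0 ->; rewrite raddf0 mul0r.
Qed.

Lemma hval0 e v : hval e v 0 = 0.
Proof. by rewrite /hval msupp0 big_nil. Qed.

Lemma hvalD e v f g : hval e v (f + g) = hval e v f + hval e v g.
Proof.
pose k := maxn (msize (f + g)) (maxn (msize f) (msize g)).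
rewrite !(@hvalE e v _ k) ?leq_max ?leqnn ?orbT // -big_split /=.
by apply: eq_bigr => m _; rewrite mcoeffD rmorphD mulrDl.
Qed.

Lemma hvalN e v f : hval e v (- f) = - hval e v f.
Proof.
by apply/eqP; rewrite -addr_eq0 -hvalD addNr hval0.
Qed.

Lemma hval_sum (I : Type) (r : seq I) (P : pred I) (F : I -> {mpoly R[n]}) e v :
  hval e v (\sum_(k <- r | P k) F k) = \sum_(k <- r | P k) hval e v (F k).
Proof. exact: (big_morph _ (hvalD e v) (hval0 e v)). Qed.

Lemma hvalZX e v c m : hval e v (c *: 'X_[m]) = h c * mnm_hval e v m.
Proof.
have [->|c0] := eqVneq c 0; first by rewrite scale0r hval0 rmorph0 mul0r.
by rewrite /hval msuppMCX // big_seq1 mcoeffZ mcoeffX eqxx mulr1.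
Qed.

Lemma eq_hval e e' v v' f : e =1 e' -> v =1 v' -> hval e v f = hval e' v' f.
Proof.
move=> He Hv; apply: eq_bigr => m _; congr (_ * _).
by apply: eq_bigr => i _; rewrite He Hv.
Qed.

Lemma hval1 v : hval (fun=> 0%N) v 1 = 1.
Proof.
rewrite /hval msupp1 big_seq1 mcoeff1 eqxx rmorph1 mul1r /mnm_hval.
by rewrite big1 // => i _; rewrite mnm0E !expr0 mulr1.
Qed.

Lemma hvalM e1 e2 v f g : mdeg_le e1 f -> mdeg_le e2 g ->
  hval (fun i => e1 i + e2 i)%N v (f * g) = hval e1 v f * hval e2 v g.
Proof.
move=> Hf Hg; rewrite {1}(mpolyE f) {1}(mpolyE g) big_distrlr /= hval_sum.
rewrite {2 3}/hval big_distrlr /=; apply: eq_big_seq => m1 /Hf H1.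
rewrite hval_sum; apply: eq_big_seq => m2 /Hg H2.
rewrite -scalerAl -scalerAr scalerA -mpolyXD hvalZX rmorphM mulrACA.
congr (_ * _); rewrite -big_split; apply: eq_bigr => i _ /=.
(* The truncated subtractions are exact by the two degree bounds. *)
have -> : (e1 i + e2 i - (m1 + m2)%MM i = (e1 i - m1 i) + (e2 i - m2 i))%N.
  by rewrite mnmDE subnDA -addnBAC // addnBA.
by rewrite mnmDE !exprD mulrACA.
Qed.

Lemma hval_prod (I : Type) (r : seq I) (e : I -> 'I_n -> nat)
    (F : I -> {mpoly R[n]}) v :
  (forall k, mdeg_le (e k) (F k)) ->
  hval (fun i => \sum_(k <- r) e k i)%N v (\prod_(k <- r) F k) =
  \prod_(k <- r) hval (e k) v (F k).
Proof.
move=> HF; elim: r => [|k r IHr].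
  by rewrite !big_nil -(hval1 v); apply: eq_hval => // i; rewrite big_nil.
rewrite !big_cons -IHr -hvalM //; last exact: mdeg_le_prod.
by apply: eq_hval => // i; rewrite big_cons.
Qed.

Lemma hval_det N (e : 'I_N -> 'I_n -> nat) (M : 'M[{mpoly R[n]}]_N) v :
  (forall k j, mdeg_le (e k) (M k j)) ->
  hval (fun i => \sum_k e k i)%N v (\det M) =
  \det (\matrix_(k, j) hval (e k) v (M k j)).
Proof.
move=> HM; rewrite hval_sum; apply: eq_bigr => s _.
have := @hval_prod _ (index_enum 'I_N) e (fun k => M k (s k)) v (fun k => HM k _).
rewrite !mulr_sign => H; rewrite [in RHS](eq_bigr _ (fun k _ => mxE _ _ k (s k))) /=.
by case: (s : bool); rewrite ?hvalN H.
Qed.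

Lemma hval_affine e v f : (forall i, (v i).2 = 1) ->
  hval e v f = (map_mpoly h f).@[fun i => (v i).1].
Proof.
move=> v1; rewrite [X in map_mpoly h X](mpolyE f) (raddf_sum (map_mpoly h)) (raddf_sum (meval _)).
apply: eq_bigr => m _ /=.
rewrite map_mpolyZ mevalZ map_mpolyX mevalX; congr (_ * _).
by apply: eq_bigr => i _; rewrite v1 expr1n mulr1.
Qed.
End HomogeneousValue.

(** * Expansion in powers of the last variable *)

Section LastVariable.
Variables (R : comNzRingType) (a m : nat) (s : 'I_a -> 'I_m).
Hypothesis s_inj : injective s.
Implicit Type f : {mpoly R[a.+1]}.

Definition push_mnm (mu : 'X_{1..a.+1}) : 'X_{1..m} :=
  (\sum_k U_(s k) *+ mu (lift ord_max k))%MM.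

Lemma push_mnmE mu k : push_mnm mu (s k) = mu (lift ord_max k).
Proof.
rewrite mnm_sumE (bigD1 k) //= mulmnE mnm1E eqxx mul1n big1 ?addn0 // => j jk.
by rewrite mulmnE mnm1E (inj_eq s_inj) (negPf jk).
Qed.

Lemma push_mnm0 mu i : i \notin codom s -> push_mnm mu i = 0%N.
Proof.
move=> Hi; rewrite mnm_sumE big1 // => k _; rewrite mulmnE mnm1E.
by case: eqP Hi => // <-; rewrite codom_f.
Qed.

Lemma mpoly_lastE f : mpoly_last s f =
  \sum_(mu <- msupp f) (f@_mu *: 'X_[push_mnm mu])%:P * 'X^(mu ord_max).
Proof.
apply: eq_bigr => mu _ /=; rewrite -mul_mpolyC polyCM -mulrA; congr (_ * _).
rewrite /mmap1 big_ord_recr /= unlift_none; congr (_ * _).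
rewrite -mprodXnE rmorph_prod; apply: eq_bigr => k _ /=.
have -> : widen_ord (leqnSn a) k = lift ord_max k.
  by apply: val_inj; rewrite /= /bump leqNgt ltn_ord.
by rewrite liftK rmorphXn.
Qed.

Lemma coef_mpoly_last f k : (mpoly_last s f)`_k =
  \sum_(mu <- msupp f | mu ord_max == k) f@_mu *: 'X_[push_mnm mu].
Proof.
rewrite mpoly_lastE coef_sum [RHS]big_mkcond; apply: eq_bigr => mu _.
by rewrite coefCM coefXn eq_sym; case: eqP => _; rewrite ?mulr1 ?mulr0.
Qed.

(** Multidegree of the coefficients: variables outside the image of [s] do not occur in them. *)
Definition on_image (d : nat) (i : 'I_m) : nat := if i \in codom s then d else 0.

Lemma mdeg_le_last f d k :
  mdeg_le (fun=> d) f -> mdeg_le (on_image d) (mpoly_last s f)`_k.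
Proof.
move=> Hf; rewrite coef_mpoly_last; apply: mdeg_le_sum => mu Hmu _.
apply: mdeg_leZX => i; rewrite /on_image; case: ifPn => [/codomP[j ->]|Hi].
  by rewrite push_mnmE Hf.
by rewrite push_mnm0.
Qed.

Lemma coef_last_eq0 f d k :
  mdeg_le (fun=> d) f -> (d < k)%N -> (mpoly_last s f)`_k = 0.
Proof.
move=> Hf dk; rewrite coef_mpoly_last big_seq_cond big1 // => mu /andP[Hmu /eqP E].
by have := Hf mu Hmu ord_max; rewrite E leqNgt dk.
Qed.

Definition ext_last (T : Type) (v : 'I_m -> T) (z : T) (i : 'I_a.+1) : T :=
  if unlift ord_max i is Some k then v (s k) else z.

(** Each monomial of [f] feeds exactly one power of the last variable; its other exponents sit on
    the image of [s], and off the image all factors are 1. *)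
Lemma hval_last (S : comNzRingType) (h : {rmorphism R -> S}) f d v z :
  mdeg_le (fun=> d) f ->
  hval h (fun=> d) (ext_last v z) f =
  \sum_(k < d.+1) hval h (on_image d) v (mpoly_last s f)`_k
                  * (z.1 ^+ k * z.2 ^+ (d - k)).
Proof.
move=> Hf.
under eq_bigr => k _ do rewrite coef_mpoly_last hval_sum big_mkcond big_distrl /=.
rewrite exchange_big; apply: eq_big_seq => mu Hmu /=.
have lt_mu : (mu ord_max < d.+1)%N by rewrite ltnS Hf.
rewrite (bigD1 (Ordinal lt_mu)) //= eqxx big1 ?addr0; last first.
  move=> k; rewrite -val_eqE eq_sym /= => /negPf ->; by rewrite mul0r.
rewrite hvalZX -mulrA; congr (_ * _).
rewrite /mnm_hval big_ord_recr /=.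
have -> : ext_last v z ord_max = z by rewrite /ext_last unlift_none.
congr (_ * _).
have mem_im i : (i \in [set s k | k : 'I_a]) = (i \in codom s).
  by apply/imsetP/codomP => [[k _ ->]|[k ->]]; exists k.
rewrite [RHS](bigID (mem [set s k | k : 'I_a])) /= [X in _ * X]big1 ?mulr1; last first.
  move=> i; rewrite mem_im => Hi.
  by rewrite /on_image (negPf Hi) push_mnm0 // !expr0 mulr1.
rewrite big_imset; last by move=> i j _ _; exact: s_inj.
apply: eq_bigr => k _; rewrite push_mnmE /on_image codom_f.
have -> : widen_ord (leqnSn a) k = lift ord_max k.
  by apply: val_inj; rewrite /= /bump leqNgt ltn_ord.
by rewrite /ext_last liftK.
Qed.
End LastVariable.

(** * Sylvester determinants of binary forms *)

Section FormalSylvester.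
Variable L : fieldType.
Implicit Types p q : nat -> L.

(* The Sylvester matrix of two forms of prescribed degrees [d1] and [d2], whose
   leading coefficients may vanish. *)
Definition sylvester d1 d2 p q : 'M[L]_(d2 + d1) :=
  \matrix_(i, j) match split i with
                 | inl k => p (j - k)%N *+ (k <= j)
                 | inr k => q (j - k)%N *+ (k <= j)
                 end.

(** A Sylvester row applied to the vector of monomials of degree [N - 1] in [z] and [t] is the value
    of the form times a monomial. *)
Lemma sum_shift d k N p (z t : L) : (k + d < N)%N ->
  (forall l, (d < l)%N -> p l = 0) ->
  \sum_(j < N) (p (j - k)%N *+ (k <= j)) * (z ^+ j * t ^+ (N.-1 - j)) =
  z ^+ k * t ^+ (N.-1 - k - d) * \sum_(l < d.+1) p l * (z ^+ l * t ^+ (d - l)).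
Proof.
move=> ltN p0.
rewrite -(big_mkord xpredT (fun j => (p (j - k)%N *+ (k <= j)) * (z ^+ j * t ^+ (N.-1 - j)))).
rewrite (big_cat_nat (n := k)) //=; last by rewrite ltnW // (leq_ltn_trans _ ltN) // leq_addr.
rewrite big_nat big1 ?add0r; last first.
  by move=> j /andP[_ jk]; rewrite leqNgt jk mul0r.
rewrite (big_cat_nat (n := k + d.+1)) ?leq_addr ?addnS //=.
rewrite [X in _ + X]big_nat [X in _ + X]big1 ?addr0; last first.
  move=> j /andP[kj _]; rewrite p0 ?mul0rn ?mul0r //.
  by rewrite ltn_subRL.
rewrite -addnS -{1}[k]add0n big_addn addKn big_mkord mulr_sumr; apply: eq_bigr => l _.
rewrite addnK leq_addl mulr1n exprD.
have le_l : (l <= d)%N by rewrite -ltnS.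
have -> : (N.-1 - (l + k) = (N.-1 - k - d) + (d - l))%N by lia.
rewrite exprD; ring.
Qed.

(** At a common zero (z : t) the vector of monomials of degree [d1 + d2 - 1] lies in the kernel. *)
Lemma det_sylvester_eq0 d1 d2 p q (z t : L) : (0 < d1)%N ->
  (forall l, (d1 < l)%N -> p l = 0) -> (forall l, (d2 < l)%N -> q l = 0) ->
  \sum_(l < d1.+1) p l * (z ^+ l * t ^+ (d1 - l)) = 0 ->
  \sum_(l < d2.+1) q l * (z ^+ l * t ^+ (d2 - l)) = 0 ->
  (z != 0) || (t != 0) -> \det (sylvester d1 d2 p q) = 0.
Proof.
move=> d1_gt0 p0 q0 pz qz zt; rewrite -det_tr; apply/eqP/det0P.
exists (\row_j (z ^+ j * t ^+ ((d2 + d1).-1 - j))).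
  apply/negP => /eqP/rowP H.
  (* The vector is nonempty because [d1] is positive; its first entry is a power of [t] and its last
     one a power of [z]. *)
  have lt0 : (0 < d2 + d1)%N by rewrite addn_gt0 d1_gt0 orbT.
  have ltm : ((d2 + d1).-1 < d2 + d1)%N by rewrite prednK.
  case/orP: zt => [z0|t0].
    by have /eqP := H (Ordinal ltm); rewrite !mxE subnn mulr1 expf_eq0 (negPf z0) andbF.
  by have /eqP := H (Ordinal lt0); rewrite !mxE subn0 mul1r expf_eq0 (negPf t0) andbF.
apply/rowP=> i; rewrite !mxE.
under eq_bigr => j _ do rewrite !mxE mulrC.
case: splitP => k _.
  rewrite (sum_shift _ _ (d := d1)) ?pz ?mulr0 //.
  by rewrite ltn_add2r.
rewrite (sum_shift _ _ (d := d2)) ?qz ?mulr0 //.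
by rewrite addnC ltn_add2l.
Qed.

(** The matrix is lower triangular, with [d2] diagonal entries [c] followed by [d1] entries
    [q d2]. *)
Lemma det_sylvester_constl d1 d2 p q c :
  (forall l, p l = c *+ (l == 0%N)) -> (forall l, (d2 < l)%N -> q l = 0) ->
  \det (sylvester d1 d2 p q) = c ^+ d2 * q d2 ^+ d1.
Proof.
move=> pE q0; rewrite det_trig.
  rewrite big_split_ord /=; congr (_ * _).
    rewrite -[in RHS](card_ord d2) -prodr_const; apply: eq_bigr => i _.
    by rewrite mxE (unsplitK (inl i)) leqnn subnn pE eqxx.
  rewrite -[in RHS](card_ord d1) -prodr_const; apply: eq_bigr => i _.
  by rewrite mxE (unsplitK (inr i)) /= leq_addl addnK.
apply/is_trig_mxP => i j ij; rewrite mxE; case: splitP => k Ei.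
  rewrite -Ei in ij *; rewrite pE subn_eq0 leqNgt ij /=.
  by rewrite !mul0rn.
rewrite q0 ?mul0rn //; rewrite Ei in ij.
by rewrite ltn_subRL addnC.
Qed.

(** Exchanging the two blocks permutes the rows. The sign depends on the sizes only, hence the
    quantifier over the forms comes after it. *)
Lemma det_sylvesterC d1 d2 : exists b : bool, forall p q,
  \det (sylvester d1 d2 p q) = (-1) ^+ b * \det (sylvester d2 d1 q p).
Proof.
pose swap (i : 'I_(d2 + d1)) : 'I_(d2 + d1) :=
  match split (cast_ord (addnC d2 d1) i) with
  | inl k => rshift d2 k
  | inr k => lshift d1 k
  end.
have swap_inj : injective swap.
  pose swap' (i : 'I_(d2 + d1)) : 'I_(d2 + d1) :=
    cast_ord (addnC d1 d2) (match split i with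
      | inl k => rshift d1 k
      | inr k => lshift d2 k
    end).
  apply: (can_inj (g := swap')) => i; rewrite /swap /swap'.
  have castK x : cast_ord (addnC d2 d1) (cast_ord (addnC d1 d2) x) = x.
    exact: val_inj.
  apply: (can_inj (cast_ordK (addnC d2 d1))); rewrite castK.
  rewrite -[in RHS](splitK (cast_ord (addnC d2 d1) i)).
  case: (split (cast_ord _ i)) => k.
    by rewrite (unsplitK (inr k)).
  by rewrite (unsplitK (inl k)).
have E p q : castmx (addnC d1 d2, addnC d1 d2) (sylvester d2 d1 q p) =
         row_perm (perm swap_inj) (sylvester d1 d2 p q).
  apply/matrixP => i j; rewrite castmxE !mxE permE /swap.
  have -> : cast_ord (esym (addnC d1 d2)) i = cast_ord (addnC d2 d1) i by apply: val_inj.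
  case: (split (cast_ord _ i)) => k.
    by rewrite (unsplitK (inr k)).
  by rewrite (unsplitK (inl k)).
exists (perm swap_inj : bool) => p q.
have -> : \det (sylvester d2 d1 q p) =
          \det (castmx (addnC d1 d2, addnC d1 d2) (sylvester d2 d1 q p)).
  by case: _ / (addnC d1 d2); rewrite castmx_id.
by rewrite E row_permE det_mulmx det_perm mulrA -signr_addb addbb mul1r.
Qed.
End FormalSylvester.

(** * Homogenized evaluation of a resultant *)

Section HomogeneousResultant.
Variables (R : comNzRingType) (a b d1 d2 : nat).
Variables (f : {mpoly R[a.+1]}) (g : {mpoly R[b.+1]}).
Hypotheses (le_f : mdeg_le (fun=> d1) f) (le_g : mdeg_le (fun=> d2) g).

Local Notation p := (mpoly_last (@lshift a b) f).
Local Notation q := (mpoly_last (@rshift a b) g).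

Hypotheses (sz_p : size p = d1.+1) (sz_q : size q = d2.+1).

Let row_deg (i : 'I_(d2 + d1)) : 'I_(a + b) -> nat :=
  match split i with
  | inl _ => on_image (@lshift a b) d1
  | inr _ => on_image (@rshift a b) d2
  end.

(** A variable of [f] has degree [d1] in [d2] rows, a variable of [g] has degree [d2] in [d1] rows,
    and neither occurs in the other rows. *)
Let sum_row_deg k : (\sum_i row_deg i k = d1 * d2)%N.
Proof.
rewrite big_split_ord /=.
under eq_bigr => i _ do rewrite /row_deg (unsplitK (inl i)).
under [X in (_ + X)%N]eq_bigr => i _ do rewrite /row_deg (unsplitK (inr i)).
rewrite !sum_nat_const !card_ord /on_image -{1 2}(splitK k).
case: (split k) => j /=.
  rewrite codom_f ifN ?muln0 ?addn0 1?mulnC //.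
  by apply/codomP => -[l /eqP]; rewrite eq_lrshift.
rewrite codom_f ifN ?muln0 //.
by apply/codomP => -[l /eqP]; rewrite eq_rlshift.
Qed.

Let sylM : 'M[{mpoly R[a + b]}]_(d2 + d1) :=
  \matrix_(i, j) match split i with
                 | inl k => p`_(j - k) *+ (k <= j)
                 | inr k => q`_(j - k) *+ (k <= j)
                 end.

(** The resultant is built from the actual sizes of both polynomials, so this is where these must
    match the formal degrees. *)
Let resultantE : resultant p q = \det sylM.
Proof.
rewrite /sylM; have -> : d1 = (size p).-1 by rewrite sz_p.
have -> : d2 = (size q).-1 by rewrite sz_q.
by congr (\det _); apply/matrixP => i j; rewrite Sylvester_mxE mxE; case: (split i).
Qed.

Let le_sylM i j : mdeg_le (row_deg i) (sylM i j).
Proof.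
rewrite mxE /row_deg; case: (split i) => k; case: (k <= j)%N; rewrite ?mulr1n ?mulr0n;
  by [exact: mdeg_le0 | apply: mdeg_le_last; first exact: lshift_inj
     | apply: mdeg_le_last; first exact: rshift_inj].
Qed.

Lemma mdeg_le_resultant : mdeg_le (fun=> (d1 * d2)%N) (resultant p q).
Proof.
rewrite resultantE => mu Hmu i; rewrite -(sum_row_deg i).
exact: (mdeg_le_det le_sylM).
Qed.

Lemma hval_resultant (L : fieldType) (h : {rmorphism R -> L}) v :
  hval h (fun=> (d1 * d2)%N) v (resultant p q) =
  \det (sylvester d1 d2 (fun k => hval h (on_image (@lshift a b) d1) v p`_k)
                        (fun k => hval h (on_image (@rshift a b) d2) v q`_k)).
Proof.
rewrite resultantE -(eq_hval _ _ sum_row_deg (frefl v)).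
rewrite hval_det //; congr (\det _); apply/matrixP => i j; rewrite !mxE /row_deg.
by case: (split i) => k; case: (k <= j)%N; rewrite ?mulr1n ?mulr0n ?hval0.
Qed.
End HomogeneousResultant.

(** * Semaev's theorem *)

Section Semaev.
Variables (F : fieldType) (L : closedFieldType) (h : {rmorphism F -> L}) (A B : F).
Hypothesis two_neq0 : 2%:R != 0 :> L.
Hypothesis disc_neq0 : 4%:R * (h A) ^+ 3 + 27%:R * (h B) ^+ 2 != 0.

Local Notation E := (curve_pt two_neq0 disc_neq0).

Definition xcoord (P : point L) : L * L := if P is Aff x _ then (x, 1) else (1, 0).

Definition inf_but n (i : 'I_n) (z : L * L) (j : 'I_n) : L * L :=
  if j == i then z else (1, 0).

(* The fourth clause makes the degree in each variable exactly [d], so that the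
   resultants defining the summation polynomials are determinants of Sylvester
   matrices of the expected size. *)
Definition semaev_spec n (f : {mpoly F[n]}) d :=
  [/\ (2 < n)%N, (0 < d)%N, mdeg_le (fun=> d) f,
      forall i, exists2 c, c != 0 &
        forall x w, hval h (fun=> d) (inf_but i (x, w)) f = c * w ^+ d
    & forall P : 'I_n -> E, \sum_i P i = 0 ->
        hval h (fun=> d) (fun i => xcoord (ecval (P i))) f = 0].

Lemma inf_but_last a m (s : 'I_a -> 'I_m) k : injective s ->
  forall z, ext_last s (inf_but (s k) z) (1, 0) =1 inf_but (lift ord_max k) z.
Proof.
move=> s_inj z j; rewrite /ext_last /inf_but; case: unliftP => [l ->|->].
  by rewrite (inj_eq s_inj) (inj_eq lift_inj).
by rewrite (negPf (neq_lift _ _)).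
Qed.

Lemma inf_but_ord_max a m (s : 'I_a -> 'I_m) i z z' : i \notin codom s ->
  ext_last s (inf_but i z') z =1 inf_but ord_max z.
Proof.
move=> Hi j; rewrite /ext_last /inf_but; case: unliftP => [l ->|->].
  rewrite [lift _ _ == _]eq_sym (negPf (neq_lift _ _)) ifN //.
  by apply: contraNneq Hi => <-; rewrite codom_f.
by rewrite eqxx.
Qed.

(** Sending the last variable to infinity isolates the coefficient of degree [d]. With one other
    variable finite and the rest at infinity, its value is a nonzero constant. *)
Lemma size_mpoly_last a m (s : 'I_a -> 'I_m) (f : {mpoly F[a.+1]}) d :
  injective s -> semaev_spec f d -> size (mpoly_last s f) = d.+1.
Proof.
move=> s_inj [gt2 _ le_f ci _]; apply/eqP; rewrite eqn_leq; apply/andP; split.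
  by apply/leq_sizeP => k dk; exact: coef_last_eq0 le_f dk.
(* Having more than two variables guarantees one besides the last. *)
case: a s s_inj f gt2 le_f ci => // a s s_inj f _ le_f ci.
have [c c0 cE] := ci (lift ord_max ord0).
apply: contraNT c0; rewrite -leqNgt => /leq_sizeP/(_ d (leqnn d)) pd0.
rewrite -[c]mulr1 -[X in c * X](expr1n L d) -(cE 0 1).
rewrite -(eq_hval _ _ (frefl _) (inf_but_last _ s_inj _)).
rewrite (hval_last s_inj) // big_ord_recr /= pd0 hval0 mul0r addr0 big1 // => k _.
by rewrite expr0n subn_eq0 leqNgt ltn_ord mulr0 mulr0.
Qed.

Lemma sum_at_inf (p : nat -> L) d :
  \sum_(k < d.+1) p k * (1 ^+ k * 0 ^+ (d - k)) = p d.
Proof.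
rewrite big_ord_recr /= subnn !expr1n !mulr1 big1 ?add0r // => k _.
by rewrite expr0n subn_eq0 leqNgt ltn_ord !mulr0.
Qed.

Lemma const_form (p : nat -> L) d c :
  (forall k, (d < k)%N -> p k = 0) ->
  (forall x, \sum_(k < d.+1) p k * (x ^+ k * 1 ^+ (d - k)) = c) ->
  forall k, p k = c *+ (k == 0%N).
Proof.
move=> p0 pc; pose r := \poly_(k < d.+1) p k.
have rc x : r.[x] = c.
  by rewrite horner_poly -(pc x); apply: eq_bigr => k _; rewrite expr1n mulr1.
(* The polynomial [r - (c + 1)] takes only the value -1. It has no root in the closed field [L],
   hence is constant. *)
have [/size_poly1P [e e0 E]|/closed_rootP [x]] := boolP (size (r - (c + 1)%:P) == 1%N).
  have Er : r = (c + 1 + e)%:P by rewrite polyCD -E addrC subrK.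
  have Ec : c + 1 + e = c by rewrite -[RHS](rc 0) Er hornerC.
  move=> k; have -> : p k = r`_k.
    by rewrite coef_poly; case: ltnP => // /p0.
  by rewrite Er Ec coefC; case: eqP.
rewrite /root !hornerE rc opprD addrA subrr sub0r oppr_eq0.
by rewrite oner_eq0.
Qed.

Lemma hval_inf_last a m (s : 'I_a -> 'I_m) (f : {mpoly F[a.+1]}) d k :
  injective s -> semaev_spec f d -> exists2 c, c != 0 & forall x w,
  hval h (on_image s d) (inf_but (s k) (x, w)) (mpoly_last s f)`_d = c * w ^+ d.
Proof.
move=> s_inj [_ _ le_f ci _]; have [c c0 cE] := ci (lift ord_max k).
exists c => // x w; rewrite -(cE x).
rewrite -(eq_hval _ _ (frefl _) (inf_but_last _ s_inj _)) (hval_last s_inj) //=.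
exact/esym/(sum_at_inf (fun l => hval h (on_image s d) _ (mpoly_last s f)`_l)).
Qed.

(** The finite variable belongs to the other block, so all variables of [f] but the last are at
    infinity; the form in the last variable is then a constant times a power of its denominator. *)
Lemma hval_inf_const a m (s : 'I_a -> 'I_m) (f : {mpoly F[a.+1]}) d i :
  injective s -> semaev_spec f d -> i \notin codom s -> exists2 c, c != 0 &
  forall z k, hval h (on_image s d) (inf_but i z) (mpoly_last s f)`_k = c *+ (k == 0%N).
Proof.
move=> s_inj [_ _ le_f ci _] Hi; have [c c0 cE] := ci ord_max.
exists c => // z; apply: (const_form (d := d)) => [k dk|x].
  by rewrite (coef_last_eq0 _ le_f dk) hval0.
have := cE x 1; rewrite -(eq_hval _ _ (frefl _) (inf_but_ord_max _ z Hi)).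
by rewrite (hval_last s_inj) //= expr1n mulr1.
Qed.

Lemma xcoord_neq0 P : ((xcoord P).1 != 0) || ((xcoord P).2 != 0).
Proof. by case: P => [|x y] /=; rewrite oner_eq0 // orbT. Qed.

Lemma xcoordN (P : E) : xcoord (ecval (- P)) = xcoord (ecval P).
Proof. by rewrite ecvalN; case: (ecval P). Qed.

Lemma hval_last_eq0 a m (s : 'I_a -> 'I_m) (f : {mpoly F[a.+1]}) d (P : 'I_m -> E) S :
  injective s -> semaev_spec f d -> \sum_k P (s k) + S = 0 ->
  let z := xcoord (ecval S) in
  \sum_(k < d.+1)
    hval h (on_image s d) (fun i => xcoord (ecval (P i))) (mpoly_last s f)`_k
    * (z.1 ^+ k * z.2 ^+ (d - k)) = 0.
Proof.
move=> s_inj [_ _ le_f _ f0] PS z; rewrite -(hval_last s_inj) //.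
rewrite -(f0 (ext_last s P S)); last first.
  apply: etrans PS; rewrite big_ord_recr /=; congr (_ + _); last by rewrite /ext_last unlift_none.
  apply: eq_bigr => k _; have -> : widen_ord (leqnSn a) k = lift ord_max k.
    by apply: val_inj; rewrite /= /bump leqNgt ltn_ord.
  by rewrite /ext_last liftK.
by apply: eq_hval => // j; rewrite /ext_last; case: unlift.
Qed.

Lemma semaev_resultant a b (f : {mpoly F[a.+1]}) (g : {mpoly F[b.+1]}) d1 d2 :
  semaev_spec f d1 -> semaev_spec g d2 ->
  semaev_spec
    (resultant (mpoly_last (@lshift a b) f) (mpoly_last (@rshift a b) g)) (d1 * d2).
Proof.
move=> Hf Hg; have [a_gt d1_gt le_f _ _] := Hf; have [b_gt d2_gt le_g _ _] := Hg.
have sz_p := size_mpoly_last (@lshift_inj a b) Hf.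
have sz_q := size_mpoly_last (@rshift_inj a b) Hg.
have hvalE := hval_resultant le_f le_g sz_p sz_q h.
split; [by lia|by rewrite muln_gt0 d1_gt|exact: mdeg_le_resultant| |].
  move=> i; rewrite -(splitK i); case: (split i) => k /=.
    (* Finite variable in the first block: the form of [g] is the constant one, and the blocks are
       exchanged to get a triangular matrix. *)
    have [c c0 cE] := hval_inf_last k (@lshift_inj a b) Hf.
    have [|c' c'0 cE'] := hval_inf_const (i := lshift b k) (@rshift_inj a b) Hg.
      by apply/codomP => -[l /eqP]; rewrite eq_lrshift.
    have [e detC] := det_sylvesterC L d1 d2.
    exists ((-1) ^+ e * (c' ^+ d1 * c ^+ d2)).
      by rewrite mulf_neq0 ?signr_eq0 ?mulf_neq0 ?expf_neq0.
    move=> x w; rewrite hvalE detC (@det_sylvester_constl _ _ _ _ _ c').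
    - by rewrite cE exprMn -exprM !mulrA.
    - by move=> l; rewrite cE'.
    - by move=> l lt_l; rewrite (coef_last_eq0 _ le_f lt_l) hval0.
  (* Finite variable in the second block: the form of [f] is the constant one. *)
  have [c c0 cE] := hval_inf_last k (@rshift_inj a b) Hg.
  have [|c' c'0 cE'] := hval_inf_const (i := rshift a k) (@lshift_inj a b) Hf.
    by apply/codomP => -[l /eqP]; rewrite eq_rlshift.
  exists (c' ^+ d2 * c ^+ d1); first by rewrite mulf_neq0 ?expf_neq0.
  move=> x w; rewrite hvalE (@det_sylvester_constl _ _ _ _ _ c').
  - by rewrite cE exprMn -exprM mulrA (mulnC d2).
  - by move=> l; rewrite cE'.
  - by move=> l lt_l; rewrite (coef_last_eq0 _ le_g lt_l) hval0.
move=> P sumP; rewrite hvalE.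
(* The first block completed by S and the second one completed by - S both add up to zero, and S and
   - S have the same abscissa: a common zero of the two forms. *)
pose S := \sum_k P (rshift a k); rewrite big_split_ord /= -/S in sumP.
pose z := xcoord (ecval S).
apply: (@det_sylvester_eq0 _ _ _ _ _ z.1 z.2) => //.
- by move=> l lt_l; rewrite (coef_last_eq0 _ le_f lt_l) hval0.
- by move=> l lt_l; rewrite (coef_last_eq0 _ le_g lt_l) hval0.
- by apply: hval_last_eq0 sumP => //; exact: lshift_inj.
- rewrite /z -xcoordN; apply: hval_last_eq0 => //; first exact: rshift_inj.
  by rewrite /S subrr.
- exact: xcoord_neq0.
Qed.

(** * The base case: the third summation polynomial, made homogeneous of degree 2 in each
    variable *)

Definition semaev3_form (a b : L) (P0 P1 P2 : L * L) : L :=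
  let: (x0, w0) := P0 in let: (x1, w1) := P1 in let: (x2, w2) := P2 in
  (x0 * w1 - x1 * w0) ^+ 2 * x2 ^+ 2
  - 2%:R * ((x0 * w1 + x1 * w0) * (x0 * x1 + a * w0 * w1)
            + 2%:R * b * w0 ^+ 2 * w1 ^+ 2) * x2 * w2
  + ((x0 * x1 - a * w0 * w1) ^+ 2 - 4%:R * b * (x0 * w1 + x1 * w0) * w0 * w1)
    * w2 ^+ 2.

Let mnm3 i j k : 'X_{1..3} :=
  (U_(inord 0) *+ i + U_(inord 1) *+ j + U_(inord 2) *+ k)%MM.

Lemma big_ord3 (T : Type) (idx : T) (op : Monoid.law idx) (G : 'I_3 -> T) :
  \big[op/idx]_i G i = op (op (G (inord 0)) (G (inord 1))) (G (inord 2)).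
Proof.
rewrite !big_ord_recr big_ord0 /= Monoid.mul1m.
by congr (op (op _ _) _); congr (G _); apply: val_inj; rewrite /= inordK.
Qed.

Let mnm3E i j k : [/\ mnm3 i j k (inord 0) = i, mnm3 i j k (inord 1) = j
                    & mnm3 i j k (inord 2) = k].
Proof.
by split; rewrite !mnmDE !mulmnE !mnm1E -!val_eqE /= !inordK //= ?mul0n ?mul1n ?addn0.
Qed.

Let mdeg_mono3 c i j k : (i <= 2)%N -> (j <= 2)%N -> (k <= 2)%N ->
  mdeg_le (fun=> 2%N) (c *: 'X_[F, mnm3 i j k]).
Proof.
move=> Hi Hj Hk; apply: mdeg_leZX => l; have [E0 E1 E2] := mnm3E i j k.
have : val l \in iota 0 3 by rewrite mem_iota ltn_ord.
rewrite !inE => /or3P[]/eqP El;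
  [have -> : l = inord 0|have -> : l = inord 1|have -> : l = inord 2];
  rewrite ?E0 ?E1 ?E2 //; by apply: val_inj; rewrite /= inordK.
Qed.

Let hval_mono3 v c i j k : hval h (fun=> 2%N) v (c *: 'X_[mnm3 i j k]) =
  h c * ((v (inord 0)).1 ^+ i * (v (inord 0)).2 ^+ (2 - i)
         * ((v (inord 1)).1 ^+ j * (v (inord 1)).2 ^+ (2 - j))
         * ((v (inord 2)).1 ^+ k * (v (inord 2)).2 ^+ (2 - k))).
Proof.
by rewrite hvalZX /mnm_hval big_ord3; have [-> -> ->] := mnm3E i j k.
Qed.

(** Written out in monomials, the polynomial can be bounded and homogenized term by term. *)
Let semaev3_expand :
  semaev3 A%:MP_[3] B%:MP_[3] 'X_(inord 0) 'X_(inord 1) 'X_(inord 2) =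
  \sum_(t <- [:: (1, (2, 0, 2)%N); (- 2%:R, (1, 1, 2)%N); (1, (0, 2, 2)%N);
                 (- 2%:R, (2, 1, 1)%N); (- 2%:R, (1, 2, 1)%N);
                 (- 2%:R * A, (1, 0, 1)%N); (- 2%:R * A, (0, 1, 1)%N);
                 (- 4%:R * B, (0, 0, 1)%N); (1, (2, 2, 0)%N);
                 (- 2%:R * A, (1, 1, 0)%N); (A ^+ 2, (0, 0, 0)%N);
                 (- 4%:R * B, (1, 0, 0)%N); (- 4%:R * B, (0, 1, 0)%N)])
     t.1 *: 'X_[mnm3 t.2.1.1 t.2.1.2 t.2.2].
Proof.
rewrite !big_cons big_nil /= /mnm3 !mpolyXD -!mpolyXn -!mul_mpolyC /semaev3.
rewrite !(rmorphM, rmorphN, rmorphXn, rmorph1, rmorph_nat).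
ring.
Qed.

Lemma hval_semaev3 v : hval h (fun=> 2%N) v
    (semaev3 A%:MP_[3] B%:MP_[3] 'X_(inord 0) 'X_(inord 1) 'X_(inord 2)) =
  semaev3_form (h A) (h B) (v (inord 0)) (v (inord 1)) (v (inord 2)).
Proof.
rewrite semaev3_expand hval_sum !big_cons big_nil /= !hval_mono3.
case: (v _) => x0 w0; case: (v _) => x1 w1; case: (v _) => x2 w2 /=.
rewrite !(rmorphM, rmorphN, rmorphXn, rmorph1, rmorph_nat) /semaev3_form.
ring.
Qed.

(** The third abscissa is that of P0 + P1. If a summand is O or the two are opposite, the identity
    is immediate; otherwise the slope coordinates make it polynomial. *)
Lemma semaev3_form_eq0 (P0 P1 P2 : E) : P0 + P1 + P2 = 0 ->
  semaev3_form (h A) (h B) (xcoord (ecval P0)) (xcoord (ecval P1))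
    (xcoord (ecval P2)) = 0.
Proof.
move=> sum0; have E2 : P2 = - (P0 + P1) by rewrite -[RHS]addr0 -sum0 addKr.
rewrite E2 xcoordN ecvalD.
have := ecvalP P0; have := ecvalP P1.
case: (ecval P0) => [|x0 y0]; case: (ecval P1) => [|x1 y1] C1 C0.
- by rewrite /=; ring.
- by rewrite /=; ring.
- by rewrite /=; ring.
have [/andP[/eqP Ex /eqP Ey]|nopp] := boolP ((x0 == x1) && (y0 == - y1)).
  by rewrite Ex Ey {3}/xcoord /padd !eqxx /=; ring.
have [l sl ->] := padd_slope_ex two_neq0 C0 C1 nopp.
have [_ Ea Eb] := slopeE C0 sl.
by rewrite /= Eb Ea; ring.
Qed.

Lemma semaev_spec3 : semaev_spec
  (semaev3 A%:MP_[3] B%:MP_[3] 'X_(inord 0) 'X_(inord 1) 'X_(inord 2)) 2.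
Proof.
split=> //.
- rewrite semaev3_expand; apply: mdeg_le_sum => t Ht _; apply: mdeg_mono3;
    by move: Ht; rewrite !inE => Ht; repeat case/orP: Ht => [/eqP -> //|Ht];
      move/eqP: Ht => ->.
(* With two variables at infinity the form reduces to [w ^+ 2]. *)
- move=> i; exists 1; rewrite ?oner_eq0 // => x w; rewrite hval_semaev3 mul1r.
  have : val i \in iota 0 3 by rewrite mem_iota ltn_ord.
  rewrite !inE => /or3P[]/eqP Ei;
    rewrite /inf_but -!val_eqE Ei /= !inordK //=; ring.
move=> P sum0; rewrite hval_semaev3; apply: semaev3_form_eq0.
by rewrite -sum0 big_ord3.
Qed.

Lemma summation_poly_spec n (f : {mpoly F[n]}) :
  summation_poly A B f -> exists d, semaev_spec f d.
Proof.
elim=> [|a b f1 f2 _ [d1 H1] _ [d2 H2]]; first by exists 2; exact: semaev_spec3.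
by exists (d1 * d2)%N; exact: semaev_resultant.
Qed.
End Semaev.

(** * Frobenius orbits *)

Lemma rational_map (k L : fieldType) (h : {rmorphism k -> L}) (a b : k) P :
  rational h (h a) (h b) P <-> exists2 P', curve a b P' & P = point_map h P'.
Proof.
split=> [[]|[P' CP' ->]]; last first.
  split; first exact/curve_map.
  by case: P' {CP'} => //= x y; split; [exists x | exists y].
case: P => [|x y] CP; first by exists Inf.
case=> -[x' _ Ex] [y' _ Ey]; exists (Aff x' y'); last by rewrite /= Ex Ey.
by apply/(curve_map h); rewrite /= Ex Ey.
Qed.

(** The additive group of F is an elementary abelian p-group, so q is a power of the characteristic;
    this makes the q-th power map additive. *)
Lemma pnat_pchar_card (F : finFieldType) (L : fieldType) (h : {rmorphism F -> L}) :
  [pchar L].-nat #|F|.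
Proof.
have [p p_pr p_char] := finPcharP F.
have := abelem_pgroup (fin_ring_pchar_abelem p_char); rewrite /pgroup cardsT.
by apply: sub_in_pnat => l _ /eqP ->; rewrite -(fmorph_pchar h) in p_char *.
Qed.

Lemma sumr_sign (V : zmodType) (x : V) n m : (m <= n)%N ->
  \sum_(i < n) (if (i < m)%N then x else - x) = x *+ m - x *+ (n - m).
Proof.
move=> le_mn; rewrite -(big_mkord xpredT (fun i => if (i < m)%N then x else - x)).
rewrite (big_cat_nat (n := m)) //= big_nat [X in _ + X]big_nat.
under eq_bigr => i /andP[_ ->] do [].
under [X in _ + X]eq_bigr => i /andP[le_mi _] do rewrite ltnNge le_mi /=.
by rewrite -!big_nat !sumr_const_nat subn0 mulNrn.
Qed.

Section FrobeniusOrbit.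
Variables (F : finFieldType) (L : closedFieldType) (h : {rmorphism F -> L}) (A B : F).
Hypothesis two_neq0 : 2%:R != 0 :> L.
Hypothesis disc_neq0 : 4%:R * (h A) ^+ 3 + 27%:R * (h B) ^+ 2 != 0.

Local Notation E := (curve_pt two_neq0 disc_neq0).
Local Notation q := #|F|.

(** Seen as a ring endomorphism of [L] fixing the curve coefficients, the Frobenius respects the
    curve and its addition by base change. *)
Let frobL (x : L) : L := x ^+ q.

Let frobL_additive : zmod_morphism frobL.
Proof.
move=> x y; have := exprDn_pchar (x - y) y (pnat_pchar_card h).
by rewrite subrK /frobL => ->; rewrite addrK.
Qed.

Let frobL_monoid : monoid_morphism frobL.
Proof. by split=> [|x y]; rewrite /frobL ?expr1n ?exprMn. Qed.

HB.instance Definition _ := GRing.isZmodMorphism.Build L L frobL frobL_additive.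
HB.instance Definition _ := GRing.isMonoidMorphism.Build L L frobL frobL_monoid.

Let frobL_fix x : frobL (h x) = h x.
Proof. by rewrite /frobL -rmorphXn expf_card. Qed.

Lemma curve_frob P : curve (h A) (h B) P -> curve (h A) (h B) (frob q P).
Proof.
move=> CP; rewrite -(frobL_fix A) -(frobL_fix B).
exact: (curve_map frobL (h A) (h B) P).2.
Qed.

Definition efrob (P : E) : E := ec _ _ (curve_frob (ecvalP P)).

Lemma efrobD P Q : efrob (P + Q) = efrob P + efrob Q.
Proof.
apply: ecval_inj; rewrite ecvalD; apply: esym.
have := padd_map frobL (h A) (ecval P) (ecval Q).
by rewrite /= frobL_fix.
Qed.

Lemma ecval_iter_efrob i P : ecval (iter i efrob P) = iter i (frob q) (ecval P).
Proof. by elim: i => //= i <-. Qed.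

Lemma iter_efrobD i P Q : iter i efrob (P + Q) = iter i efrob P + iter i efrob Q.
Proof. by elim: i => //= i ->; rewrite efrobD. Qed.

Lemma frob_rational P : rational h (h A) (h B) P -> frob q P = P.
Proof.
by case/rational_map=> -[|x y] _ ->; rewrite //= -!rmorphXn !expf_card.
Qed.

Lemma iter_efrob_rational i P : rational h (h A) (h B) (ecval P) ->
  iter i efrob P = P.
Proof.
move=> HP; apply: ecval_inj; rewrite ecval_iter_efrob.
by elim: i => //= i ->; exact: frob_rational.
Qed.

Lemma iter_frob_aff i (x y : L) :
  iter i (frob q) (Aff x y) = Aff (x ^+ (q ^ i)) (y ^+ (q ^ i)).
Proof. by elim: i => [|i IHi] /=; rewrite ?expr1 // IHi /= -!exprM expnSr. Qed.

(* With n - k signs + and k signs -, the rational point [Q] is counted n - 2k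
   times, while the signs do not matter for the 2-torsion point [R]. *)
Lemma signed_orbit_sum (n k : nat) (Q R : E) : (2 * k <= n)%N ->
  rational h (h A) (h B) (ecval Q) -> Q *+ (n - 2 * k) = 0 -> R *+ 2 = 0 ->
  \sum_(i < n) iter i efrob R = 0 ->
  \sum_(i < n) (if (i < n - k)%N then iter i efrob (Q + R)
                else - iter i efrob (Q + R)) = 0.
Proof.
move=> le_kn ratQ Qtors R2 trR.
(* The conjugates of R are again 2-torsion, hence equal to their opposites. *)
have R2i i : - iter i efrob R = iter i efrob R.
  have H0 : efrob 0 = 0 by apply: (addrI (efrob 0)); rewrite -efrobD !addr0.
  apply/eqP; rewrite eq_sym -addr_eq0 -iter_efrobD -mulr2n R2; apply/eqP.
  by elim: i => //= i ->.
transitivity (\sum_(i < n) (if (i < n - k)%N then Q else - Q)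
              + \sum_(i < n) iter i efrob R).
  rewrite -big_split; apply: eq_bigr => i _ /=.
  by rewrite iter_efrobD iter_efrob_rational // opprD R2i; case: ifP.
rewrite trR addr0 sumr_sign ?leq_subr // subKn; last by lia.
by rewrite -mulrnBr; [rewrite -[RHS]Qtors; congr (_ *+ _); lia | lia].
Qed.

(** Signs do not change abscissae, and the conjugates of an affine point are affine, so the
    homogenized value is the ordinary one. *)
Lemma summation_poly_orbit n (f : {mpoly F[n]}) (P : E) (s : 'I_n -> bool) X Y :
  summation_poly A B f ->
  \sum_(i < n) (if s i then iter i efrob P else - iter i efrob P) = 0 ->
  ecval P = Aff X Y ->
  (map_mpoly h f).@[fun i : 'I_n => X ^+ (q ^ i)] = 0.
Proof.
move=> Hf sum0 EP; have [d [_ _ _ _ f0]] := summation_poly_spec two_neq0 disc_neq0 Hf.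
have := f0 _ sum0.
rewrite (@eq_hval _ _ _ _ _ (fun=> d) _ (fun i : 'I_n => (X ^+ (q ^ i), 1))) //; last first.
  by move=> i; case: (s i); rewrite ?xcoordN ecval_iter_efrob EP iter_frob_aff.
by rewrite hval_affine.
Qed.
End FrobeniusOrbit.

Local Open Scope classical_set_scope.

(* F = F_q, K = F_(q^n) and L is an algebraic closure of F containing K. *)
Theorem lemma13 (F K : finFieldType) (L : closedFieldType)
    (iFK : {rmorphism F -> K}) (iKL : {rmorphism K -> L})
    (A B : F) (n : nat) (f : {mpoly F[n]}) :
  let iFL := iKL \o iFK in
  let q := #|F| in
  let a := iFL A in
  let b := iFL B in
  let T := trace_zero iKL a b q n in
  (forall x : L, algebraicOver iFL x) ->
  #|K| = (q ^ n)%N ->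
  2%N \notin [pchar F] ->
  3%N \notin [pchar F] ->
  4%:R * A ^+ 3 + 27%:R * B ^+ 2 != 0 ->
  prime n ->
  odd n ->
  summation_poly A B f ->
  \bigcup_(k < n./2)
     set_padd a (torsion a b (n - 2 * k) `&` rational iFL a b)
                (torsion a b 2 `&` T)
  `<=`
  [set P | rational iKL a b P /\
           exists X Y : L, P = Aff X Y /\
             (map_mpoly iFL f).@[fun i : 'I_n => X ^+ (q ^ i)] = 0]
  `|` [set Inf].
Proof.
move=> iFL q a b T _ _ char2 _ disc _ _ Hf P [k /= ltk].
case=> Q [[CQ mQ] ratQ] [R [[CR mR] [ratR trR]] <-].
have two0 : 2%:R != 0 :> L.
  by move: char2; rewrite inE /= -(rmorph_nat iFL) fmorph_eq0.
have disc0 : 4%:R * a ^+ 3 + 27%:R * b ^+ 2 != 0.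
  rewrite /a /b -!(rmorph_nat iFL) -!rmorphXn -!rmorphM -rmorphD.
  by rewrite (fmorph_eq0 iFL).
pose Qe := ec two0 disc0 CQ; pose Re := ec two0 disc0 CR.
(* Q is defined over F and R over K, so both descend to K and are added there. *)
have ratP : rational iKL a b (padd a Q R).
  have [R' CR' ER] := (rational_map _ _ _ _).1 ratR.
  have [Q' CQ' EQ] := (rational_map iFL A B Q).1 ratQ.
  have EP : padd a Q R = point_map iKL (padd (iFK A) (point_map iFK Q') R').
    by rewrite -padd_map -ER EQ; congr padd; case: (Q').
  apply/rational_map; eexists; last exact: EP.
  by apply/(curve_map iKL); rewrite -EP; exact: curve_padd.
case E : (padd a Q R) => [|X Y]; [by right | left].
split; first by rewrite -E.
exists X, Y; split=> //.
(* Plus signs for the first n - k conjugates, minus signs for the remaining k. *)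
apply: (@summation_poly_orbit _ _ iFL A B two0 disc0 n f (Qe + Re)
         (fun i => (i < n - k)%N) X Y) => //.
apply: signed_orbit_sum => //.
- by move: ltk; lia.
- by apply: ecval_inj; rewrite ecvalMn.
- by apply: ecval_inj; rewrite ecvalMn.
apply: ecval_inj; rewrite ecval_sum; apply: etrans trR.
by apply: eq_bigr => i _; rewrite ecval_iter_efrob.
Qed.
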